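(* Let $\mathcal L$ be one of the following complex Lie algebras: the Witt algebra $\mathcal W$, the Virasoro algebra $\mathcal V$, $W(a,b)$ or $\widetilde W(a,b)$ with $a,b\in\mathbb C$, $0\le a<1$ (all defined in the context). Any commutative post-Lie algebra structure on $\mathcal L$ is trivial unless $\mathcal L=\widetilde W(0,1)$. Any nontrivial commutative post-Lie algebra structure on $\widetilde W(0,1)$ is of the form $\Lambda_{a,b,c}$ for some $a,b,c\in\mathbb C$, where $\Lambda_{a,b,c}$ is the bilinear product on $\widetilde W(0,1)$ defined by $$\Lambda_{a,b,c}(I_0+x,I_0+y)=aC_0+bC_1^1+cC_2^1\quad\text{for any }x,y\in\widetilde W(0,1)',$$ with $\widetilde W(0,1)'=[\widetilde W(0,1),\widetilde W(0,1)]$ the derived subalgebra.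
   Context: All vector spaces are over $\mathbb C$; $\delta_{s,t}$ is the Kronecker delta. A commutative post-Lie algebra structure on a Lie algebra $(\mathfrak g,[\cdot,\cdot])$ is a bilinear product $\circ$ on $\mathfrak g$ such that for all $x,y,z\in\mathfrak g$: $x\circ y=y\circ x$, $[x,y]\circ z=x\circ(y\circ z)-y\circ(x\circ z)$, and $x\circ[y,z]=[x\circ y,z]+[y,x\circ z]$. It is trivial if $x\circ y=0$ for all $x,y\in\mathfrak g$. Witt algebra $\mathcal W$: basis $\{L_n\mid n\in\mathbb Z\}$, $[L_m,L_n]=(m-n)L_{m+n}$. Virasoro algebra $\mathcal V$: basis $\{L_n,C_0\mid n\in\mathbb Z\}$, $C_0$ central, $[L_m,L_n]=(m-n)L_{m+n}+\frac1{12}(m^3-m)\delta_{m+n,0}C_0$. $W(a,b)$: basis $\{L_n,I_n\mid n\in\mathbb Z\}$, $[L_i,L_j]=(i-j)L_{i+j}$, $[L_i,I_j]=-(a+j+bi)I_{i+j}$, $[I_i,I_j]=0$. $\widetilde W(a,b)$ (universal central extension of $W(a,b)$): basis $\{L_n,I_n\mid n\in\mathbb Z\}$ together with those of the central elements $C_0,C_1^0,C_1^1,C_2^1,C_1^{-1},C_2^0,C_2^{\frac12,0}$ that occur in the following brackets for the given $(a,b)$ (that is: $C_0$ always; $C_1^0,C_2^0$ if $(a,b)=(0,0)$; $C_1^1,C_2^1$ if $(a,b)=(0,1)$; $C_1^{-1}$ if $(a,b)=(0,-1)$; $C_2^{\frac12,0}$ if $(a,b)=(\frac12,0)$), with $$[L_m,L_n]=(m-n)L_{m+n}+\tfrac{m^3-m}{12}\delta_{m+n,0}C_0,$$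 $$[L_m,I_n]=-(a+n+bm)I_{m+n}+\delta_{m+n,0}\delta_{a,0}\left((m^2+m)\delta_{b,0}C_1^0+\delta_{b,1}(mC_1^1+C_2^1)+\tfrac{m^3-m}{12}\delta_{b,-1}C_1^{-1}\right),$$ $$[I_m,I_n]=m\,\delta_{m+n,0}\delta_{a,0}\delta_{b,0}C_2^0+(2m+1)\delta_{m+n+1,0}\delta_{a,\frac12}\delta_{b,0}C_2^{\frac12,0}.$$ The derived subalgebra of $\widetilde W(0,1)$ is $\widetilde W(0,1)'=\mathrm{span}_{\mathbb C}\{L_i,I_j,C_0,C_1^1,C_2^1\mid i\in\mathbb Z,\ j\in\mathbb Z\setminus\{0\}\}$, so $\widetilde W(0,1)=\mathbb CI_0\oplus\widetilde W(0,1)'$. In $\Lambda_{a,b,c}$ the letters $a,b,c$ are arbitrary complex parameters, unrelated to the parameters of $W(a,b)$. *)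

(* Defs.v *)
From HB Require Import structures.
From mathcomp Require Import all_boot all_order all_algebra.
From mathcomp Require Import finmap.
From mathcomp Require Export sesquilinear reals complex monalg.
From mathcomp Require Import ring.

Set Implicit Arguments.
Unset Strict Implicit.
Unset Printing Implicit Defensive.

Import Order.TTheory GRing.Theory Num.Theory.
Local Open Scope ring_scope.

Record lieAlgebra (K : fieldType) := LieAlgebra {
  lie_space :> lmodType K;
  lie_bracket : {bilinear lie_space -> lie_space -> lie_space};
  lie_bracketxx : forall x, lie_bracket x x = 0;
  lie_jacobi : forall x y z,
    lie_bracket x (lie_bracket y z) + lie_bracket y (lie_bracket z x) +
    lie_bracket z (lie_bracket x y) = 0
}.

Notation "lie[ x , y ]" := (lie_bracket _ x y)
  (at level 0, x at level 99, y at level 99, format "lie[ x ,  y ]").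

Definition derived_subalgebra (K : fieldType) (g : lieAlgebra K) (x : g) : Prop :=
  exists s : seq (K * (g * g)), x = \sum_(t <- s) t.1 *: lie[t.2.1, t.2.2].

Record commutative_post_lie (K : fieldType) (g : lieAlgebra K)
    (mu : {bilinear g -> g -> g}) : Prop := CommutativePostLie {
  cpl_comm : forall x y, mu x y = mu y x;
  cpl_bracketl : forall x y z,
    mu lie[x, y] z = mu x (mu y z) - mu y (mu x z);
  cpl_bracketr : forall x y z,
    mu x lie[y, z] = lie[mu x y, z] + lie[y, mu x z]
}.

Definition trivial_product (K : fieldType) (g : lieAlgebra K)
    (mu : {bilinear g -> g -> g}) : Prop :=
  forall x y, mu x y = 0.

(* {malg K[T]} is the vector space of finitely supported functions T -> K:
   it has basis << i >>, i : T, and x@_i is the coordinate of x along << i >>. *)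
Section LinearExtension.
Variables (K : fieldType) (T : choiceType) (V : lmodType K).

Definition lin_ext (f : T -> V) (x : {malg K[T]}) : V :=
  \sum_(i <- msupp x) x@_i *: f i.

Lemma lin_extEw f x (d : {fset T}) : (msupp x `<=` d)%fset ->
  lin_ext f x = \sum_(i <- d) x@_i *: f i.
Proof.
move=> le_xd; rewrite /lin_ext (big_fset_incl _ le_xd) // => i _ ni.
by rewrite mcoeff_outdom // scale0r.
Qed.

Lemma lin_ext_is_linear f : linear (lin_ext f).
Proof.
move=> c x y; pose d := (msupp (c *: x + y) `|` (msupp x `|` msupp y))%fset.
rewrite !(@lin_extEw f _ d) ?fsubsetUl //; last 2 first.
- by rewrite /d fsetUA fsubsetUr.
- by apply: fsubset_trans (fsubsetUr _ _); rewrite fsubsetUl.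
rewrite scaler_sumr -big_split /=; apply: eq_bigr => i _.
by rewrite mcoeffD mcoeffZ scalerDl scalerA.
Qed.

HB.instance Definition _ f := GRing.isLinear.Build K {malg K[T]} V _ (lin_ext f)
  (lin_ext_is_linear f).

Lemma lin_extU f i : lin_ext f << i >> = f i.
Proof.
by rewrite (lin_extEw _ msuppU_le) big_seq_fset1 mcoeffUU scale1r.
Qed.

Lemma malg_basisE (x : {malg K[T]}) : x = \sum_(i <- msupp x) x@_i *: << i >>.
Proof.
rewrite {1}[x]monalgE; apply: eq_bigr => i _; apply/malgP => k.
by rewrite mcoeffZ !mcoeffU mulrnAr mulr1.
Qed.

End LinearExtension.

Lemma malg_ind_lin (K : fieldType) (T : choiceType) (P : {malg K[T]} -> Prop) :
  P 0 -> (forall c x y, P x -> P y -> P (c *: x + y)) ->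
  (forall i, P << i >>) -> forall x, P x.
Proof.
move=> P0 PD PU x; rewrite [x]malg_basisE.
elim: (X in \sum_(i <- X) _) => [|i s IHs]; first by rewrite big_nil.
by rewrite big_cons; apply: PD.
Qed.

Section BilinearExtension.
Variables (K : fieldType) (T : choiceType) (V : lmodType K).

Definition bilin_ext (f : T -> T -> V) (x y : {malg K[T]}) : V :=
  lin_ext (fun i => lin_ext (f i) y) x.

Lemma bilin_ext_is_bilinear f : bilinear_for *:%R *:%R (bilin_ext f).
Proof.
split=> [y c x x'|x c y y'] /=; first exact: linearP.
rewrite /bilin_ext {1}/lin_ext /lin_ext scaler_sumr -big_split /=.
apply: eq_bigr => i _; rewrite -!/(lin_ext _ _) linearP.
by rewrite scalerDr !scalerA mulrC.
Qed.

HB.instance Definition _ f :=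
  bilinear_isBilinear.Build K {malg K[T]} {malg K[T]} V _ _ (bilin_ext f)
    (bilin_ext_is_bilinear f).

Lemma bilin_extUU f i j : bilin_ext f << i >> << j >> = f i j.
Proof. by rewrite /bilin_ext !lin_extU. Qed.

Lemma bilin_extPl f c x x' y :
  bilin_ext f (c *: x + x') y = c *: bilin_ext f x y + bilin_ext f x' y.
Proof. exact: (bilin_ext_is_bilinear f).1. Qed.

Lemma bilin_extPr f c x y y' :
  bilin_ext f x (c *: y + y') = c *: bilin_ext f x y + bilin_ext f x y'.
Proof. exact: (bilin_ext_is_bilinear f).2. Qed.

Lemma bilin_ext0l f y : bilin_ext f 0 y = 0.
Proof. exact: linear0l. Qed.

Lemma bilin_ext0r f x : bilin_ext f x 0 = 0.
Proof. exact: linear0r. Qed.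

Lemma bilin_extDr f x y y' :
  bilin_ext f x (y + y') = bilin_ext f x y + bilin_ext f x y'.
Proof. exact: linearDr. Qed.

Lemma bilin_extNr f x y : bilin_ext f x (- y) = - bilin_ext f x y.
Proof. exact: linearNr. Qed.

Lemma bilin_extZr f c x y : bilin_ext f x (c *: y) = c *: bilin_ext f x y.
Proof. by rewrite -[c *: y]addr0 bilin_extPr bilin_ext0r addr0. Qed.

End BilinearExtension.

Lemma add3_cycle (V : zmodType) (u v w : V) : u + v + w = 0 -> v + w + u = 0.
Proof. by rewrite -addrA addrC. Qed.

Lemma add3_eq0 (V : zmodType) (u v w u' v' w' : V) :
  u = u' -> v = v' -> w = w' -> u' + v' + w' = 0 -> u + v + w = 0.
Proof. by move=> -> -> ->. Qed.

Lemma add3_split (V : zmodType) (u v w u' v' w' : V) :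
  u + v + w = 0 -> u' + v' + w' = 0 -> (u + u') + (v + v') + (w + w') = 0.
Proof. by move=> h h'; rewrite (addrACA u) (addrACA (u + v)) h h' addr0. Qed.

Section LinearCombinations.
Variables (K : fieldType) (V : lmodType K).
Implicit Types (a b c : K) (u v : V).

Lemma lincomb3 a b c u : a + b + c = 0 -> a *: u + b *: u + c *: u = 0.
Proof. by move=> h; rewrite -!scalerDl h scale0r. Qed.

Lemma lincomb3D a b c a' b' c' u v : a + b + c = 0 -> a' + b' + c' = 0 ->
  (a *: u + a' *: v) + (b *: u + b' *: v) + (c *: u + c' *: v) = 0.
Proof.
move=> h h'; rewrite (addrACA (a *: u)) (addrACA (a *: u + _)) lincomb3 // add0r.
exact: lincomb3.
Qed.

Lemma lincomb2N a a' b b' u v : a = - b -> a' = - b' ->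
  a *: u + a' *: v = - (b *: u + b' *: v).
Proof. by move=> -> ->; rewrite opprD !scaleNr. Qed.

Lemma lincomb_flat c t p q r s (u v w x y : V) :
  t *: u + c *: (p *: v + q *: (r *: w + x) + s *: y) =
  t *: u + c * p *: v + c * q * r *: w + c * q *: x + c * s *: y.
Proof. by rewrite !scalerDr !scalerA !mulrA !addrA. Qed.

Lemma lincomb3_5 c1 c2 c3 t1 t2 t3 p1 p2 p3 q1 q2 q3 r1 r2 r3 s1 s2 s3
    (u v w x y : V) :
  c1 * t1 + c2 * t2 - c3 * t3 = 0 -> c1 * p1 + c2 * p2 - c3 * p3 = 0 ->
  c1 * q1 + c2 * q2 - c3 * q3 = 0 -> c1 * r1 + c2 * r2 - c3 * r3 = 0 ->
  c1 * s1 + c2 * s2 - c3 * s3 = 0 ->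
  c1 *: (t1 *: u + p1 *: v + q1 *: w + r1 *: x + s1 *: y) +
  c2 *: (t2 *: u + p2 *: v + q2 *: w + r2 *: x + s2 *: y) +
  c3 *: - (t3 *: u + p3 *: v + q3 *: w + r3 *: x + s3 *: y) = 0.
Proof.
move=> ht hp hq hr hs; rewrite scalerN -scaleNr !scalerDr !scalerA.
do 4![apply: add3_split; last by apply: lincomb3; rewrite mulNr].
by apply: lincomb3; rewrite mulNr.
Qed.

Lemma lincomb2_2 c1 c2 t1 t2 p1 p2 u v :
  c1 * t1 + c2 * t2 = 0 -> c1 * p1 + c2 * p2 = 0 ->
  c1 *: (t1 *: u + p1 *: v) + c2 *: (t2 *: u + p2 *: v) = 0.
Proof.
move=> ht hp; rewrite !scalerDr !scalerA addrACA -!scalerDl ht hp.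
by rewrite !scale0r addr0.
Qed.

End LinearCombinations.

Lemma jacobiator_linear (K : fieldType) (V : lmodType K) (B : V -> V -> V) :
  (forall c x x' y, B (c *: x + x') y = c *: B x y + B x' y) ->
  (forall c x y y', B x (c *: y + y') = c *: B x y + B x y') ->
  forall c x x' y z,
  B x (B y z) + B y (B z x) + B z (B x y) = 0 ->
  B x' (B y z) + B y (B z x') + B z (B x' y) = 0 ->
  B (c *: x + x') (B y z) + B y (B z (c *: x + x')) +
    B z (B (c *: x + x') y) = 0.
Proof.
move=> Pl Pr c x x' y z h h'; rewrite !(Pl, Pr).
rewrite (addrACA (c *: B x _)) (addrACA (c *: B x _ + _)).
by rewrite h' addr0 -!scalerDr h scaler0.
Qed.

(* The Lie algebra with basis << i >>, i : T, and bracket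
   [<< i >>, << j >>] = f i j. *)
Section StructureConstants.
Variables (K : numFieldType) (T : choiceType) (f : T -> T -> {malg K[T]}).
Hypothesis f_anti : forall i j, f i j = - f j i.
Hypothesis f_jacobi : forall i j k,
  bilin_ext f << i >> (f j k) + bilin_ext f << j >> (f k i) +
  bilin_ext f << k >> (f i j) = 0.

Lemma bilin_ext_anti x y : bilin_ext f x y = - bilin_ext f y x.
Proof.
elim/malg_ind_lin: x => [|c x x' IHx IHx'|i].
- by rewrite bilin_ext0l bilin_ext0r oppr0.
- by rewrite bilin_extPl bilin_extPr IHx IHx' opprD scalerN.
elim/malg_ind_lin: y => [|c y y' IHy IHy'|j].
- by rewrite bilin_ext0l bilin_ext0r oppr0.
- by rewrite bilin_extPl bilin_extPr IHy IHy' opprD scalerN.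
by rewrite !bilin_extUU f_anti.
Qed.

Lemma bilin_extxx x : bilin_ext f x x = 0.
Proof.
have /eqP := bilin_ext_anti x x; rewrite -addr_eq0 -mulr2n -scaler_nat.
by rewrite scaler_eq0 pnatr_eq0 /= => /eqP.
Qed.

Lemma bilin_ext_jacobi x y z :
  bilin_ext f x (bilin_ext f y z) + bilin_ext f y (bilin_ext f z x) +
  bilin_ext f z (bilin_ext f x y) = 0.
Proof.
have Pl := bilin_extPl f; have Pr := bilin_extPr f.
elim/malg_ind_lin: x => [|c x x' IHx IHx'|i].
- by rewrite !(bilin_ext0l, bilin_ext0r) !addr0.
- exact: (@jacobiator_linear _ _ _ Pl Pr c x x' y z IHx IHx').
elim/malg_ind_lin: y => [|c y y' IHy IHy'|j].
- by rewrite !(bilin_ext0l, bilin_ext0r) !addr0.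
- rewrite -addrA addrC in IHy; rewrite -addrA addrC in IHy'; rewrite -addrA addrC.
  exact: (@jacobiator_linear _ _ _ Pl Pr c y y' z << i >> IHy IHy').
elim/malg_ind_lin: z => [|c z z' IHz IHz'|k].
- by rewrite !(bilin_ext0l, bilin_ext0r) !addr0.
- rewrite addrC addrA in IHz; rewrite addrC addrA in IHz'; rewrite addrC addrA.
  exact: (@jacobiator_linear _ _ _ Pl Pr c z z' << i >> << j >> IHz IHz').
by rewrite !bilin_extUU f_jacobi.
Qed.

Definition lie_of_basis : lieAlgebra K :=
  @LieAlgebra K {malg K[T]} (bilin_ext f) bilin_extxx bilin_ext_jacobi.

End StructureConstants.

(* labels of the central elements C_0, C_1^0, C_2^0, C_1^1, C_2^1, C_1^{-1} and
   C_2^{1/2,0}, in this order *)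
Variant central_idx := cC0 | cC1_0 | cC2_0 | cC1_1 | cC2_1 | cC1_m1 | cC2_half0.

Definition central_code (c : central_idx) : nat :=
  match c with
  | cC0 => 0 | cC1_0 => 1 | cC2_0 => 2 | cC1_1 => 3 | cC2_1 => 4
  | cC1_m1 => 5 | cC2_half0 => 6
  end.

Definition central_decode (n : nat) : central_idx :=
  nth cC0 [:: cC0; cC1_0; cC2_0; cC1_1; cC2_1; cC1_m1; cC2_half0] n.

Lemma central_codeK : cancel central_code central_decode.
Proof. by case. Qed.

HB.instance Definition _ := Countable.copy central_idx (can_type central_codeK).

Section Algebras.
Variable K : numFieldType.

(* Kronecker delta, with value in K *)
Definition kron (T : eqType) (s t : T) : K := (s == t)%:R.

Section Witt.

Definition witt_br (m n : int) : {malg K[int]} := (m - n)%:~R *: << m + n >>.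

Lemma witt_anti m n : witt_br m n = - witt_br n m.
Proof.
rewrite /witt_br -[RHS]scaleNr [n + m]addrC.
by congr (_ *: _); rewrite -rmorphN opprB.
Qed.

Lemma witt_jacobi i j k :
  bilin_ext witt_br << i >> (witt_br j k) +
  bilin_ext witt_br << j >> (witt_br k i) +
  bilin_ext witt_br << k >> (witt_br i j) = 0.
Proof.
have E m n p : bilin_ext witt_br << m >> (witt_br n p) =
    ((n - p)%:~R * (m - (n + p))%:~R) *: << m + (n + p) >>.
  by rewrite [witt_br n p]/witt_br bilin_extZr bilin_extUU /witt_br scalerA.
rewrite !E (_ : j + (k + i) = i + (j + k)); last by ring.
rewrite (_ : k + (i + j) = i + (j + k)); last by ring.
apply: lincomb3; ring.
Qed.

Definition witt : lieAlgebra K := lie_of_basis witt_anti witt_jacobi.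

End Witt.

Section Virasoro.

Definition vir_idx := (int + unit)%type.
Definition virL (n : int) : {malg K[vir_idx]} := << inl n >>.
Definition virC0 : {malg K[vir_idx]} := << inr tt >>.

Definition vir_br (s t : vir_idx) : {malg K[vir_idx]} :=
  match s, t with
  | inl m, inl n =>
      (m - n)%:~R *: virL (m + n) +
      ((m ^+ 3 - m)%:~R / 12%:R * kron (m + n) 0) *: virC0
  | _, _ => 0
  end.

Lemma vir_anti s t : vir_br s t = - vir_br t s.
Proof.
case: s t => [m|[]] [n|[]]; rewrite /vir_br ?oppr0 //.
rewrite [n + m]addrC; apply: lincomb2N; first by rewrite -rmorphN opprB.
rewrite /kron; case: eqP => [h|_]; last by rewrite !mulr0 oppr0.
have -> : n = - m by rewrite -[n](addKr m) h addr0.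
by ring.
Qed.

Lemma vir_jacobi s t u :
  bilin_ext vir_br << s >> (vir_br t u) +
  bilin_ext vir_br << t >> (vir_br u s) +
  bilin_ext vir_br << u >> (vir_br s t) = 0.
Proof.
have E m n p : bilin_ext vir_br << inl m >> (vir_br (inl n) (inl p)) =
    ((n - p)%:~R * (m - (n + p))%:~R) *: virL (m + (n + p)) +
    ((n - p)%:~R * ((m ^+ 3 - m)%:~R / 12%:R * kron (m + (n + p)) 0)) *: virC0.
  rewrite [vir_br (inl n) _]/vir_br bilin_extDr !bilin_extZr !bilin_extUU /vir_br.
  by rewrite scaler0 addr0 scalerDr !scalerA.
have E0 (v : unit) m n : bilin_ext vir_br << inr v >> (vir_br (inl m) (inl n)) = 0.
  rewrite [vir_br (inl m) _]/vir_br bilin_extDr !bilin_extZr !bilin_extUU /vir_br.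
  by rewrite !scaler0 addr0.
case: s t u => [i|[]] [j|[]] [k|[]];
  rewrite /=
    ?bilin_ext0r ?E0 ?add0r ?addr0 //.
rewrite !E (_ : j + (k + i) = i + (j + k)); last by ring.
rewrite (_ : k + (i + j) = i + (j + k)); last by ring.
apply: lincomb3D; first by ring.
rewrite /kron; case: eqP => [h|_]; last by rewrite !mulr0 !addr0.
rewrite (_ : i = - (j + k)); last by rewrite -[LHS](addrK (j + k)) h add0r.
by rewrite /= !mulr1; ring.
Qed.

Definition virasoro : lieAlgebra K := lie_of_basis vir_anti vir_jacobi.

End Virasoro.

Section W.
Variables a b : K.

Definition W_idx := (int + int)%type.
Definition WL (n : int) : {malg K[W_idx]} := << inl n >>.
Definition WI (n : int) : {malg K[W_idx]} := << inr n >>.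

Definition W_br (s t : W_idx) : {malg K[W_idx]} :=
  match s, t with
  | inl m, inl n => (m - n)%:~R *: WL (m + n)
  | inl m, inr n => - (a + n%:~R + b * m%:~R) *: WI (m + n)
  | inr n, inl m => (a + n%:~R + b * m%:~R) *: WI (m + n)
  | inr m, inr n => 0
  end.

Lemma W_anti s t : W_br s t = - W_br t s.
Proof.
case: s t => [m|m] [n|n]; rewrite /W_br.
- by rewrite [n + m]addrC -[RHS]scaleNr -rmorphN opprB.
- by rewrite [LHS]scaleNr.
- by rewrite -[RHS]scaleNr opprK.
- by rewrite oppr0.
Qed.

Lemma W_jacobi s t u :
  bilin_ext W_br << s >> (W_br t u) +
  bilin_ext W_br << t >> (W_br u s) +
  bilin_ext W_br << u >> (W_br s t) = 0.
Proof.
have E0 m n p : bilin_ext W_br << inl m >> (W_br (inl n) (inl p)) =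
    ((n - p)%:~R * (m - (n + p))%:~R) *: WL (m + (n + p)).
  by rewrite [W_br (inl n) _]/W_br bilin_extZr bilin_extUU /W_br scalerA.
have E1 m n p : bilin_ext W_br << inl m >> (W_br (inl n) (inr p)) =
    ((a + p%:~R + b * n%:~R) * (a + (n + p)%:~R + b * m%:~R)) *: WI (m + (n + p)).
  rewrite [W_br (inl n) _]/W_br bilin_extZr bilin_extUU /W_br scalerA.
  by rewrite mulrNN.
have E2 m n p : bilin_ext W_br << inl m >> (W_br (inr p) (inl n)) =
    - ((a + p%:~R + b * n%:~R) * (a + (n + p)%:~R + b * m%:~R)) *: WI (m + (n + p)).
  rewrite [W_br (inr p) _]/W_br bilin_extZr bilin_extUU /W_br scalerA.
  by rewrite mulrN.
have E3 m n p : bilin_ext W_br << inr p >> (W_br (inl m) (inl n)) =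
    ((m - n)%:~R * (a + p%:~R + b * (m + n)%:~R)) *: WI (m + n + p).
  by rewrite [W_br (inl m) _]/W_br bilin_extZr bilin_extUU /W_br scalerA.
have E4 m n p : bilin_ext W_br << inr p >> (W_br (inl m) (inr n)) = 0.
  by rewrite [W_br (inl m) _]/W_br bilin_extZr bilin_extUU /W_br scaler0.
have E5 m n p : bilin_ext W_br << inr p >> (W_br (inr n) (inl m)) = 0.
  by rewrite [W_br (inr n) _]/W_br bilin_extZr bilin_extUU /W_br scaler0.
have LLI i j k : bilin_ext W_br << inl i >> (W_br (inl j) (inr k)) +
    bilin_ext W_br << inl j >> (W_br (inr k) (inl i)) +
    bilin_ext W_br << inr k >> (W_br (inl i) (inl j)) = 0.
  rewrite E1 E2 E3 (_ : j + (i + k) = i + (j + k)); last by ring.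
  by rewrite -(addrA i); apply: lincomb3; ring.
case: s t u => [i|i] [j|j] [k|k].
- rewrite !E0 (_ : j + (k + i) = i + (j + k)); last by ring.
  rewrite (_ : k + (i + j) = i + (j + k)); last by ring.
  by apply: lincomb3; ring.
- exact: LLI.
- exact: (add3_cycle (LLI k i j)).
- by rewrite E4 E5 /= bilin_ext0r !addr0.
- exact: (add3_cycle (add3_cycle (LLI j k i))).
- by rewrite E4 E5 /= bilin_ext0r !addr0.
- by rewrite E4 E5 /= bilin_ext0r !addr0.
- by rewrite /= !bilin_ext0r !addr0.
Qed.

Definition W : lieAlgebra K := lie_of_basis W_anti W_jacobi.

End W.

Section Wtilde.
Variables a b : K.

Definition occurs (c : central_idx) : bool :=
  match c with
  | cC0 => true
  | cC1_0 | cC2_0 => (a == 0) && (b == 0)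
  | cC1_1 | cC2_1 => (a == 0) && (b == 1)
  | cC1_m1 => (a == 0) && (b == -1)
  | cC2_half0 => (a == 2%:R^-1) && (b == 0)
  end.

Definition Wt_idx := (int + int + {c : central_idx | occurs c})%type.
Definition WtL (n : int) : {malg K[Wt_idx]} := << inl (inl n) >>.
Definition WtI (n : int) : {malg K[Wt_idx]} := << inl (inr n) >>.

(* the central basis vector indexed by c if it occurs for (a, b), 0 otherwise *)
Definition WtC (c : central_idx) : {malg K[Wt_idx]} :=
  if insub c is Some c' then << inr c' >> else 0.

Definition Wt_brLI (m n : int) : {malg K[Wt_idx]} :=
  - (a + n%:~R + b * m%:~R) *: WtI (m + n) +
  (kron (m + n) 0 * kron a 0) *:
    (((m ^+ 2 + m)%:~R * kron b 0) *: WtC cC1_0 +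
     kron b 1 *: (m%:~R *: WtC cC1_1 + WtC cC2_1) +
     ((m ^+ 3 - m)%:~R / 12%:R * kron b (-1)) *: WtC cC1_m1).

Definition Wt_br (s t : Wt_idx) : {malg K[Wt_idx]} :=
  match s, t with
  | inl (inl m), inl (inl n) =>
      (m - n)%:~R *: WtL (m + n) +
      ((m ^+ 3 - m)%:~R / 12%:R * kron (m + n) 0) *: WtC cC0
  | inl (inl m), inl (inr n) => Wt_brLI m n
  | inl (inr n), inl (inl m) => - Wt_brLI m n
  | inl (inr m), inl (inr n) =>
      (m%:~R * kron (m + n) 0 * kron a 0 * kron b 0) *: WtC cC2_0 +
      ((2 * m + 1)%:~R * kron (m + n + 1) 0 * kron a 2%:R^-1 * kron b 0)
        *: WtC cC2_half0
  | _, _ => 0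
  end.

Lemma Wt_anti s t : Wt_br s t = - Wt_br t s.
Proof.
case: s t => [[m|m]|c] [[n|n]|d] //=; rewrite ?opprK ?oppr0 // [n + m]addrC.
  apply: lincomb2N; first by rewrite -rmorphN opprB.
  rewrite /kron; case: eqP => [h|_]; last by rewrite !mulr0 oppr0.
  rewrite (_ : n = - m); first by rewrite /= !mulr1; ring.
  by rewrite -[LHS](addKr m) h addr0.
apply: lincomb2N.
  rewrite /kron; case: (m + n =P 0) => [h|_]; last by rewrite !(mulr0, mul0r) oppr0.
  rewrite (_ : n = - m); first by ring.
  by rewrite -[LHS](addKr m) h addr0.
rewrite /kron; case: (m + n + 1 =P 0) => [h|_]; last by rewrite !(mulr0, mul0r) oppr0.
rewrite (_ : n = - (m + 1)); first by ring.
by rewrite -[LHS](addrK (m + 1)) addrA [n + m]addrC h add0r.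
Qed.

Lemma Wt_brC s c : bilin_ext Wt_br << s >> (WtC c) = 0.
Proof.
rewrite /WtC; case: insubP => [d _ _|_]; last exact: bilin_ext0r.
by rewrite bilin_extUU; case: s => [[]|].
Qed.

Lemma Wt_brLIE m n : Wt_brLI m n =
  - (a + n%:~R + b * m%:~R) *: WtI (m + n) +
  kron (m + n) 0 * kron a 0 * ((m ^+ 2 + m)%:~R * kron b 0) *: WtC cC1_0 +
  kron (m + n) 0 * kron a 0 * kron b 1 * m%:~R *: WtC cC1_1 +
  kron (m + n) 0 * kron a 0 * kron b 1 *: WtC cC2_1 +
  kron (m + n) 0 * kron a 0 * ((m ^+ 3 - m)%:~R / 12%:R * kron b (-1))
    *: WtC cC1_m1.
Proof. exact: lincomb_flat. Qed.

Lemma Wt_br_LLI (i j k : int) :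
  - (a + k%:~R + b * j%:~R) *: Wt_brLI i (j + k) +
  (a + k%:~R + b * i%:~R) *: Wt_brLI j (i + k) +
  (i - j)%:~R *: - Wt_brLI (i + j) k = 0.
Proof.
rewrite !Wt_brLIE (_ : j + (i + k) = i + (j + k)); last by ring.
rewrite -(addrA i); apply: lincomb3_5; first by ring.
all: rewrite !/kron; case: (i + (j + k) =P 0) => [h|_];
  last by rewrite !(mul0r, mulr0, addr0, oppr0).
all: rewrite (_ : k = - (i + j));
  last by rewrite -[LHS](addKr (i + j)) -(addrA i) h addr0.
all: case: (a =P 0) => [->|_]; last by rewrite !(mul0r, mulr0, addr0, oppr0).
- by case: (b =P 0) => [->|_]; rewrite /=; ring.
- by case: (b =P 1) => [->|_]; rewrite /=; ring.
- by case: (b =P 1) => [->|_]; rewrite /=; ring.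
- by case: (b =P -1) => [->|_]; rewrite /=; ring.
Qed.

Lemma Wt_br_LII (i j k : int) :
  (a + k%:~R + b * i%:~R) *: Wt_br (inl (inr j)) (inl (inr (i + k))) +
  - (a + j%:~R + b * i%:~R) *: Wt_br (inl (inr k)) (inl (inr (i + j))) = 0.
Proof.
rewrite /Wt_br (_ : j + (i + k) = i + j + k); last by ring.
rewrite [k + (i + j)]addrC; apply: lincomb2_2; rewrite !/kron.
  case: (i + j + k =P 0) => [h|_]; last by rewrite !(mul0r, mulr0) addr0.
  case: (a =P 0) => [->|_]; last by rewrite !(mul0r, mulr0) addr0.
  by case: (b =P 0) => [->|_]; rewrite /=; ring.
case: (i + j + k + 1 =P 0) => [h|_]; last by rewrite !(mul0r, mulr0) addr0.
case: (a =P 2%:R^-1) => [->|_]; last by rewrite !(mul0r, mulr0) addr0.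
by case: (b =P 0) => [->|_]; rewrite /=; field.
Qed.

Lemma Wt_br_LLL (i j k : int) :
  (j - k)%:~R *: Wt_br (inl (inl i)) (inl (inl (j + k))) +
  (k - i)%:~R *: Wt_br (inl (inl j)) (inl (inl (k + i))) +
  (i - j)%:~R *: Wt_br (inl (inl k)) (inl (inl (i + j))) = 0.
Proof.
rewrite /Wt_br (_ : j + (k + i) = i + (j + k)); last by ring.
rewrite (_ : k + (i + j) = i + (j + k)); last by ring.
rewrite !scalerDr !scalerA; apply: lincomb3D; first by ring.
rewrite /kron; case: eqP => [h|_]; last by rewrite !mulr0 !addr0.
rewrite (_ : i = - (j + k)); last by rewrite -[LHS](addrK (j + k)) h add0r.
by rewrite /= !mulr1; ring.
Qed.

Lemma Wt_jacobi s t u :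
  bilin_ext Wt_br << s >> (Wt_br t u) +
  bilin_ext Wt_br << t >> (Wt_br u s) +
  bilin_ext Wt_br << u >> (Wt_br s t) = 0.
Proof.
have ELL s' m n : bilin_ext Wt_br << s' >> (Wt_br (inl (inl m)) (inl (inl n))) =
    (m - n)%:~R *: Wt_br s' (inl (inl (m + n))).
  rewrite [Wt_br (inl (inl m)) _]/Wt_br bilin_extDr !bilin_extZr Wt_brC.
  by rewrite scaler0 addr0 bilin_extUU.
have EII s' m n :
    bilin_ext Wt_br << s' >> (Wt_br (inl (inr m)) (inl (inr n))) = 0.
  rewrite [Wt_br (inl (inr m)) _]/Wt_br bilin_extDr !bilin_extZr !Wt_brC.
  by rewrite !scaler0 addr0.
have ELI s' m n : bilin_ext Wt_br << s' >> (Wt_br (inl (inl m)) (inl (inr n))) =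
    - (a + n%:~R + b * m%:~R) *: Wt_br s' (inl (inr (m + n))).
  rewrite [Wt_br (inl (inl m)) _]/Wt_br Wt_brLIE !bilin_extDr !bilin_extZr.
  by rewrite !Wt_brC !scaler0 !addr0 bilin_extUU.
have EIL s' m n : bilin_ext Wt_br << s' >> (Wt_br (inl (inr n)) (inl (inl m))) =
    (a + n%:~R + b * m%:~R) *: Wt_br s' (inl (inr (m + n))).
  by rewrite (Wt_anti (inl (inr n))) bilin_extNr ELI scaleNr opprK.
have EC s' c t' : bilin_ext Wt_br << s' >> (Wt_br (inr c) t') = 0.
  by rewrite /Wt_br bilin_ext0r.
have EC' s' c t' : bilin_ext Wt_br << s' >> (Wt_br t' (inr c)) = 0.
  by rewrite (Wt_anti t') bilin_extNr EC oppr0.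
have ECC c t' u' : bilin_ext Wt_br << inr c >> (Wt_br t' u') = 0.
  case: t' u' => [[m|m]|d] [[n|n]|e]; rewrite ?EC ?EC' //.
  - by rewrite ELL /Wt_br scaler0.
  - by rewrite ELI /Wt_br scaler0.
  - by rewrite EIL /Wt_br scaler0.
have LLI i j k :
    bilin_ext Wt_br << inl (inl i) >> (Wt_br (inl (inl j)) (inl (inr k))) +
    bilin_ext Wt_br << inl (inl j) >> (Wt_br (inl (inr k)) (inl (inl i))) +
    bilin_ext Wt_br << inl (inr k) >> (Wt_br (inl (inl i)) (inl (inl j))) = 0.
  apply: (add3_eq0 (ELI _ j k) (EIL _ i k) (ELL _ i j)).
  exact: (Wt_br_LLI i j k).
have LII i j k :
    bilin_ext Wt_br << inl (inl i) >> (Wt_br (inl (inr j)) (inl (inr k))) +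
    bilin_ext Wt_br << inl (inr j) >> (Wt_br (inl (inr k)) (inl (inl i))) +
    bilin_ext Wt_br << inl (inr k) >> (Wt_br (inl (inl i)) (inl (inr j))) = 0.
  apply: (add3_eq0 (EII _ j k) (EIL _ i k) (ELI _ i j)); rewrite add0r.
  exact: (Wt_br_LII i j k).
case: u => [u|c]; last first.
  by apply: (add3_eq0 (EC' _ _ _) (EC _ _ _) (ECC _ _ _)); rewrite !addr0.
case: t => [t|c]; last first.
  by apply: (add3_eq0 (EC _ _ _) (ECC _ _ _) (EC' _ _ _)); rewrite !addr0.
case: s => [s|c]; last first.
  by apply: (add3_eq0 (ECC _ _ _) (EC' _ _ _) (EC _ _ _)); rewrite !addr0.
case: s t u => [i|i] [j|j] [k|k].
- apply: (add3_eq0 (ELL _ j k) (ELL _ k i) (ELL _ i j)).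
  exact: (Wt_br_LLL i j k).
- exact: LLI.
- exact: (add3_cycle (LLI k i j)).
- exact: LII.
- exact: (add3_cycle (add3_cycle (LLI j k i))).
- exact: (add3_cycle (add3_cycle (LII j k i))).
- exact: (add3_cycle (LII k i j)).
- by apply: (add3_eq0 (EII _ j k) (EII _ k i) (EII _ i j)); rewrite !addr0.
Qed.

Definition Wtilde : lieAlgebra K := lie_of_basis Wt_anti Wt_jacobi.

End Wtilde.

(* mu is Lambda_{p,q,r}: the formula determines the bilinear map mu, because
   Wtilde 0 1 is spanned by I_0 and its derived subalgebra. *)
Definition is_Lambda (p q r : K)
    (mu : {bilinear Wtilde 0 1 -> Wtilde 0 1 -> Wtilde 0 1}) : Prop :=
  forall x y : Wtilde 0 1, derived_subalgebra x -> derived_subalgebra y ->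
    mu ((WtI 0 1 0 : Wtilde 0 1) + x) ((WtI 0 1 0 : Wtilde 0 1) + y) =
    p *: WtC 0 1 cC0 + q *: WtC 0 1 cC1_1 + r *: WtC 0 1 cC2_1.

End Algebras.

(* Main.v *)
(* A commutative post-Lie product is a symmetric bilinear map all of whose
   multiplications D_x = x o _ are derivations, so that D_x preserves the centre.
   Let l_k and i_k be the coordinates along L_k and I_k. Comparing coordinates in
   the derivation rule for D_x applied to [L_p, L_q] and [L_p, I_n] - first with
   p or q = 0, where L_0 acts through the weights - and using the symmetry of the
   product, one finds that every l_k (x o y) vanishes and that x o I_n is central.
   Hence x o y lies in the span of the I_n and the centre, z o (x o y) is central,
   and the rule [x, y] o z = x o (y o z) - y o (x o z) makes all products central.
   But then x o [y, z] = 0: the product is trivial on a perfect algebra. Only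
   (a, b) = (0, 1) gives a non-perfect algebra; W(0, 1) has no centre, and in the
   other case only I_0 o I_0 survives. *)
Require Import Defs.
From mathcomp Require Import all_boot all_order all_algebra.
From mathcomp Require Import zify ring.

Set Implicit Arguments.
Unset Strict Implicit.
Unset Printing Implicit Defensive.

Import Order.TTheory GRing.Theory Num.Theory.
Local Open Scope ring_scope.

(** * Integer scalars *)

Lemma intr_mul_eq0 (K : numFieldType) (n : int) (u : K) :
  n != 0 -> n%:~R * u = 0 -> u = 0.
Proof. by move=> n0 /eqP; rewrite mulf_eq0 intr_eq0 (negPf n0) => /eqP. Qed.

(** This makes every [L m] a multiple of [lie[L p, L q]] up to a central term, with [p] and [q] also
    different from [m]. *)
Lemma int_split (m : int) :
  exists p q : int, [/\ m = p + q, p != q, p != 0 & q != 0].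
Proof.
have [->|m1] := eqVneq m (-1); first by exists 1, (-2).
have [->|m2] := eqVneq m (-2); first by exists 1, (-3).
have [->|m0] := eqVneq m 0; first by exists 1, (-1).
(* The two terms differ by [3 * m + 4], never 0, and one of them vanishes only at [m = -1] or
   [m = -2]. *)
by exists (2 * m + 2), (- m - 2); split; lia.
Qed.

(** * Central elements and commutative post-Lie products *)

Section Center.
Variables (K : fieldType) (g : lieAlgebra K).
Implicit Types x y z c : g.

Definition lie_central c := forall x, lie[c, x] = 0.

Lemma lie_bracketC x y : lie[x, y] = - lie[y, x].
Proof.
apply/eqP; rewrite -addr_eq0; have := lie_bracketxx (x + y).
by rewrite linearDl !linearDr !lie_bracketxx add0r addr0 => ->.
Qed.

Lemma lie_centralr c x : lie_central c -> lie[x, c] = 0.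
Proof. by move=> hc; rewrite lie_bracketC hc oppr0. Qed.

Lemma lie_central0 : lie_central 0.
Proof. by move=> x; rewrite linear0l. Qed.

Lemma lie_centralP k x y :
  lie_central x -> lie_central y -> lie_central (k *: x + y).
Proof. by move=> hx hy z; rewrite linearPl hx hy scaler0 addr0. Qed.

Lemma lie_centralZ k x : lie_central x -> lie_central (k *: x).
Proof. by move=> hx; rewrite -[_ *: _]addr0; apply: lie_centralP lie_central0. Qed.

Lemma lie_centralD x y : lie_central x -> lie_central y -> lie_central (x + y).
Proof. by move=> hx; rewrite -[x]scale1r; apply: lie_centralP. Qed.

Variable mu : {bilinear g -> g -> g}.
Hypothesis mu_cpl : commutative_post_lie mu.

Lemma cpl_central x c : lie_central c -> lie_central (mu x c).
Proof.
move=> hc y; have := cpl_bracketr mu_cpl x c y.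
by rewrite !hc linear0r addr0.
Qed.

Lemma cpl_derived_eq0 x y :
  (forall z t, lie_central (mu z t)) -> derived_subalgebra y -> mu x y = 0.
Proof.
move=> hmu [s ->]; rewrite linear_sumr big1_seq // => t _.
rewrite linearZr_LR (cpl_bracketr mu_cpl) hmu lie_centralr ?addr0 ?scaler0 //.
Qed.

End Center.

(* A Witt algebra up to central terms, with [lam k] the coordinate along [L k] *)
Record witt_coordinates (K : numFieldType) (g : lieAlgebra K)
    (L : int -> g) (lam : int -> g -> K) : Prop := WittCoordinates {
  lamP : forall k c x y, lam k (c *: x + y) = c * lam k x + lam k y;
  brLL : forall m n, exists2 c, lie_central c &
    lie[L m, L n] = (m - n)%:~R *: L (m + n) + c;
  lam_brL : forall k m x, lam k lie[L m, x] = (2 * m - k)%:~R * lam (k - m) x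
}.

(** * The [L]-coordinates of products of two vectors [L m], [L n] *)

Section WittPart.
Variables (K : numFieldType) (g : lieAlgebra K).
Variables (L : int -> g) (lam : int -> g -> K).
Hypothesis H : witt_coordinates L lam.

Lemma lam0 k : lam k 0 = 0.
Proof.
by have := lamP H k (-1) 0 0; rewrite scaler0 addr0 mulN1r addNr.
Qed.

Lemma lamD k x y : lam k (x + y) = lam k x + lam k y.
Proof. by have := lamP H k 1 x y; rewrite scale1r mul1r. Qed.

Lemma lamZ k c x : lam k (c *: x) = c * lam k x.
Proof. by have := lamP H k c x 0; rewrite lam0 !addr0. Qed.

Lemma lamN k x : lam k (- x) = - lam k x.
Proof. by rewrite -scaleN1r lamZ mulN1r. Qed.

Lemma lam_central k c : lie_central c -> lam k c = 0.
Proof.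
(* The bracket with [L (k + 1)] moves coordinate [k] to [2 * k + 1] with factor
   [(k + 1) - k = 1]. *)
move=> hc; have := lam_brL H (2 * k + 1) (k + 1) c.
rewrite lie_centralr // lam0 (_ : 2 * k + 1 - (k + 1) = k); last by lia.
by rewrite (_ : 2 * (k + 1) - _ = 1) ?mul1r //; lia.
Qed.

Variable mu : {bilinear g -> g -> g}.
Hypothesis mu_cpl : commutative_post_lie mu.

Lemma lam_mu_brLL x p q k :
  (p - q)%:~R * lam k (mu x (L (p + q))) =
  (k - 2 * q)%:~R * lam (k - q) (mu x (L p)) +
  (2 * p - k)%:~R * lam (k - p) (mu x (L q)).
Proof.
have [c hc E] := brLL H p q; have := cpl_bracketr mu_cpl x (L p) (L q).
rewrite {}E linearDr linearZr_LR => /(congr1 (lam k)).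
rewrite !lamD lamZ (lam_central _ (cpl_central mu_cpl x hc)) addr0 => ->.
by rewrite lie_bracketC lamN !(lam_brL H) -mulNr -rmorphN opprB.
Qed.

(** This is the derivation rule with [q = 0]: off the diagonal [k = n], products with [L n] are
    controlled by products with [L 0]. *)
Lemma lam_mu_LL0 x n k :
  (k - n)%:~R * lam k (mu x (L n)) =
  (k - 2 * n)%:~R * lam (k - n) (mu x (L 0)).
Proof.
have := lam_mu_brLL x n 0 k; rewrite mulr0 !subr0 ?addr0 => E.
by rewrite rmorphB /= mulrBl E; ring.
Qed.

Lemma lam_mu_L0_0 x : lam 0 (mu x (L 0)) = 0.
Proof.
(* At [n = k = 1] the left factor is 0 and the right one is -1. *)
have := lam_mu_LL0 x 1 1; rewrite subrr mul0r => /esym.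
by apply: intr_mul_eq0.
Qed.

Lemma lam_mu_L0L0 j : lam j (mu (L 0) (L 0)) = 0.
Proof.
have [->|j0] := eqVneq j 0; first exact: lam_mu_L0_0.
(* By symmetry the left side contains coordinate 0 of a product with [L 0], which is 0; the right
   factor is [2 * j]. *)
have := lam_mu_LL0 (L 0) (- j) 0; rewrite !sub0r opprK.
rewrite (cpl_comm mu_cpl) lam_mu_L0_0 mulr0 => /esym.
by apply: intr_mul_eq0; lia.
Qed.

Lemma lam_mu_L0L_off n k : k != n -> lam k (mu (L 0) (L n)) = 0.
Proof.
move=> kn; have := lam_mu_LL0 (L 0) n k; rewrite lam_mu_L0L0 mulr0.
by apply: intr_mul_eq0; lia.
Qed.

(** Coordinate [m + n] of [mu (L m) (L n)] can be computed with [L m] or with [L n] as the fixed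
    factor; comparing the results gives the relation times [m - n]. *)
Lemma lam_mu_L0L_cross m n : m != 0 -> n != 0 -> m != n ->
  n%:~R * lam m (mu (L 0) (L m)) + m%:~R * lam n (mu (L 0) (L n)) = 0.
Proof.
move=> m0 n0 mn.
have E1 := lam_mu_LL0 (L m) n (m + n); have E2 := lam_mu_LL0 (L n) m (m + n).
rewrite addrK in E1; rewrite [m + n - m]addrAC subrr add0r in E2.
rewrite (cpl_comm mu_cpl _ (L 0)) in E1; rewrite !(cpl_comm mu_cpl (L n)) in E2.
apply: (@intr_mul_eq0 _ (m - n)); first by lia.
transitivity (n%:~R * ((m + n - 2 * n)%:~R * lam m (mu (L 0) (L m))) -
              m%:~R * ((m + n - 2 * m)%:~R * lam n (mu (L 0) (L n)))).
  by ring.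
by rewrite -E1 -E2; ring.
Qed.

(** Put [t n = lam n (mu (L 0) (L n)) / n] for [n != 0]. The cross relation says [t m + t n = 0] for
    distinct nonzero [m], [n], and the three pairs from [n], [- n], [2 * n] force [t n = 0]. *)
Lemma lam_mu_L0L n k : lam k (mu (L 0) (L n)) = 0.
Proof.
have [->|] := eqVneq k n; last exact: lam_mu_L0L_off.
have [->|n0] := eqVneq n 0; first exact: lam_mu_L0L0.
have E1 : n%:~R * lam (- n) (mu (L 0) (L (- n))) +
          (- n)%:~R * lam n (mu (L 0) (L n)) = 0.
  by rewrite addrC; apply: lam_mu_L0L_cross; lia.
have E2 := @lam_mu_L0L_cross n (2 * n) n0 ltac:(lia) ltac:(lia).
have E3 := @lam_mu_L0L_cross (- n) (2 * n) ltac:(lia) ltac:(lia) ltac:(lia).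
apply: (@intr_mul_eq0 _ (4 * n)); first by lia.
transitivity (
  ((2 * n)%:~R * lam n (mu (L 0) (L n)) +
   n%:~R * lam (2 * n) (mu (L 0) (L (2 * n)))) +
  ((2 * n)%:~R * lam (- n) (mu (L 0) (L (- n))) +
   (- n)%:~R * lam (2 * n) (mu (L 0) (L (2 * n)))) -
  2 * (n%:~R * lam (- n) (mu (L 0) (L (- n))) +
          (- n)%:~R * lam n (mu (L 0) (L n)))).
  by ring.
by rewrite E1 E2 E3; ring.
Qed.

Lemma lam_mu_LL_off m n k : k != n -> lam k (mu (L m) (L n)) = 0.
Proof.
move=> kn; have := lam_mu_LL0 (L m) n k.
rewrite (cpl_comm mu_cpl _ (L 0)) lam_mu_L0L mulr0.
by apply: intr_mul_eq0; lia.
Qed.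

(** By symmetry only coordinate [n] of [mu (L n) (L n)] could survive. Splitting one factor [L n] as
    a bracket of [L p] and [L q] reduces it to products of distinct basis vectors. *)
Lemma lam_mu_LL m n k : lam k (mu (L m) (L n)) = 0.
Proof.
have [->|] := eqVneq k n; last exact: lam_mu_LL_off.
have [->|mn] := eqVneq m n; last first.
  by rewrite (cpl_comm mu_cpl) lam_mu_LL_off // eq_sym.
have off p j : p != n -> lam j (mu (L n) (L p)) = 0.
  have [->|jp] := eqVneq j p; last by rewrite lam_mu_LL_off.
  by move=> pn; rewrite (cpl_comm mu_cpl) lam_mu_LL_off.
have [p [q [E pq p0 q0]]] := int_split n.
have := lam_mu_brLL (L n) p q n; rewrite -E.
rewrite (off p) ?(off q) ?mulr0 ?addr0; [|lia|lia].
by apply: intr_mul_eq0; lia.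
Qed.

End WittPart.

(** For [a = b = 0] the vector [I 0] is central, so [iota 0] need not vanish on the centre; this
    exceptional index is excluded in the coordinate arguments. *)
Definition central_index (K : numFieldType) (a b : K) (n : int) : bool :=
  [&& a == 0, b == 0 & n == 0].

(* The algebra [W(a, b)] up to central terms. As every element of the algebra is
   a combination of the [L n], the [I n] and central elements, [W_ind] proves
   a linear property of [x] by looking only at the vectors occurring in [x]. *)
Record W_coordinates (K : numFieldType) (a b : K) (g : lieAlgebra K)
    (L I : int -> g) (lam iota : int -> g -> K) : Prop := WCoordinates {
  W_witt : witt_coordinates L lam;
  iotaP : forall k c x y, iota k (c *: x + y) = c * iota k x + iota k y;
  brLI : forall m n, exists2 c, lie_central c &
    lie[L m, I n] = - (a + n%:~R + b * m%:~R) *: I (m + n) + c;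
  lam_brI : forall k n x, lam k lie[I n, x] = 0;
  iota_brL : forall k m x, iota k lie[L m, x] =
    - (a + (k - m)%:~R + b * m%:~R) * iota (k - m) x;
  iota_brI : forall k n x, iota k lie[I n, x] =
    (a + n%:~R + b * (k - n)%:~R) * lam (k - n) x;
  central_indexP : forall n, central_index a b n -> lie_central (I n);
  W_ind : forall (P : g -> Prop) x, P 0 ->
    (forall c y z, P y -> P z -> P (c *: y + z)) ->
    (forall n, lam n x != 0 -> P (L n)) ->
    (forall n, iota n x != 0 -> P (I n)) ->
    (forall c, lie_central c -> P c) -> P x
}.

(** * Centrality of all products in algebras with coordinates along [L] and [I] *)

Section WPart.
Variables (K : numFieldType) (a b : K) (g : lieAlgebra K).
Variables (L I : int -> g) (lam iota : int -> g -> K).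
Hypothesis H : W_coordinates a b L I lam iota.
(** This is what [0 <= a < 1] provides: the eigenvalue [- (a + j)] of [L 0] on [I j] vanishes only
    for [a = j = 0]. *)
Hypothesis a_int : forall j : int, a + j%:~R = 0 -> a = 0 /\ j = 0.

Let HL := W_witt H.

Lemma iota0 k : iota k 0 = 0.
Proof.
by have := iotaP H k (-1) 0 0; rewrite scaler0 addr0 mulN1r addNr.
Qed.

Lemma iotaD k x y : iota k (x + y) = iota k x + iota k y.
Proof. by have := iotaP H k 1 x y; rewrite scale1r mul1r. Qed.

Lemma iotaZ k c x : iota k (c *: x) = c * iota k x.
Proof. by have := iotaP H k c x 0; rewrite iota0 !addr0. Qed.

Lemma iotaN k x : iota k (- x) = - iota k x.
Proof. by rewrite -scaleN1r iotaZ mulN1r. Qed.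

Lemma iota_central k c : lie_central c -> ~~ central_index a b k ->
  iota k c = 0.
Proof.
(* The action of [L 0] settles every case but [a = k = 0]. *)
move=> hc; have := iota_brL H k 0 c.
rewrite lie_centralr // iota0 subr0 mulr0 addr0 => /esym/eqP.
rewrite mulf_eq0 oppr_eq0 => /orP[/eqP /a_int[a0 k0]|/eqP //].
rewrite /central_index a0 k0 !eqxx andbT /= => b0.
(* Now [b != 0], and [L 1] moves coordinate 0 to coordinate 1 with factor [- b]. *)
have := iota_brL H 1 1 c; rewrite lie_centralr // iota0 subrr a0 addr0 add0r mulr1.
by move/esym/eqP; rewrite mulf_eq0 oppr_eq0 (negPf b0) => /eqP.
Qed.

Variable mu : {bilinear g -> g -> g}.
Hypothesis mu_cpl : commutative_post_lie mu.

Lemma lam_mu_brLI x p n k :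
  - (a + n%:~R + b * p%:~R) * lam k (mu x (I (p + n))) =
  (2 * p - k)%:~R * lam (k - p) (mu x (I n)).
Proof.
have [c hc E] := brLI H p n; have := cpl_bracketr mu_cpl x (L p) (I n).
rewrite {}E linearDr linearZr_LR => /(congr1 (lam k)).
rewrite !(lamD HL) (lamZ HL) (lam_central HL _ (cpl_central mu_cpl x hc)) addr0.
move=> ->; rewrite lie_bracketC (lamN HL) (lam_brI H) oppr0 add0r.
exact: (lam_brL HL).
Qed.

(** The rule at [p = 0] compares the weight [a + n] of [I n] with the weight [k] of [L k]; by
    [a_int] they agree only if [k = n]. *)
Lemma lam_mu_I_off x n k : k != n -> lam k (mu x (I n)) = 0.
Proof.
move=> kn; have := lam_mu_brLI x 0 n k.
rewrite !mulr0 sub0r subr0 !addr0 add0r => E.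
have : (a + (n - k)%:~R) * lam k (mu x (I n)) = 0.
  transitivity ((- k)%:~R * lam k (mu x (I n)) -
    - (a + n%:~R) * lam k (mu x (I n))); first by ring.
  by rewrite E subrr.
move/eqP; rewrite mulf_eq0 => /orP[/eqP /a_int[_ nk]|/eqP //].
by case/eqP: kn; lia.
Qed.

Lemma lam_mu_IL m n k : lam k (mu (I n) (L m)) = 0.
Proof.
have [->|kn] := eqVneq k n; last by rewrite (cpl_comm mu_cpl) lam_mu_I_off.
have [p [q [-> pq p0 q0]]] := int_split m.
(* The right side is read at coordinates [n - q] and [n - p], both different from [n]. *)
have := lam_mu_brLL HL mu_cpl (I n) p q n; rewrite !(cpl_comm mu_cpl (I n) (L _)).
rewrite (@lam_mu_I_off (L p)) ?(@lam_mu_I_off (L q)) ?mulr0 ?addr0; [|lia|lia].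
by apply: intr_mul_eq0; lia.
Qed.

Lemma lam_mu_II m n k : lam k (mu (I m) (I n)) = 0.
Proof.
have [->|kn] := eqVneq k n; last exact: lam_mu_I_off.
have [<-|nm] := eqVneq n m; last by rewrite (cpl_comm mu_cpl) lam_mu_I_off.
(* At coordinate [n + p] the left product is off the diagonal after swapping its factors, as
   [p != 0]; the right factor is [p - n]. *)
have [p [p0 pn]] : exists p : int, p != 0 /\ p != n.
  by have [->|n1] := eqVneq n 1; [exists 2 | exists 1; split; lia].
have := lam_mu_brLI (I n) p n (n + p).
rewrite (cpl_comm mu_cpl _ (I (p + n))) lam_mu_I_off ?mulr0 ?addrK; last by lia.
by move/esym; apply: intr_mul_eq0; lia.
Qed.

Lemma lam_mu x y k : lam k (mu x y) = 0.
Proof.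
have lam1 c z z' : lam k z = 0 -> lam k z' = 0 -> lam k (c *: z + z') = 0.
  by move=> h h'; rewrite (lamP HL) h h' mulr0 addr0.
have lamC z c : lie_central c -> lam k (mu z c) = 0.
  by move=> hc; apply: (lam_central HL); apply: cpl_central.
apply: (W_ind H (P := fun z => lam k (mu z y) = 0)) => [|c z z'|m _|m _|c hc].
- by rewrite linear0l (lam0 HL).
- by rewrite linearPl; apply: lam1.
- apply: (W_ind H (P := fun z => lam k (mu (L m) z) = 0)) => [|c z z'|n _|n _|c hc].
  + by rewrite linear0r (lam0 HL).
  + by rewrite linearPr; apply: lam1.
  + exact: (lam_mu_LL HL mu_cpl).
  + by rewrite (cpl_comm mu_cpl) lam_mu_IL.
  + exact: lamC.
- apply: (W_ind H (P := fun z => lam k (mu (I m) z) = 0)) => [|c z z'|n _|n _|c hc].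
  + by rewrite linear0r (lam0 HL).
  + by rewrite linearPr; apply: lam1.
  + exact: lam_mu_IL.
  + exact: lam_mu_II.
  + exact: lamC.
- by rewrite (cpl_comm mu_cpl) lamC.
Qed.

(** Since [mu x (L p)] has no [L]-coordinate, its bracket with [I n] has no [I]-coordinate, and only
    the action of [L p] on [mu x (I n)] remains. *)
Lemma iota_mu_brLI x p n k : ~~ central_index a b k ->
  (a + n%:~R + b * p%:~R) * iota k (mu x (I (p + n))) =
  (a + (k - p)%:~R + b * p%:~R) * iota (k - p) (mu x (I n)).
Proof.
move=> hk; have [c hc E] := brLI H p n.
have := cpl_bracketr mu_cpl x (L p) (I n).
rewrite {}E linearDr linearZr_LR => /(congr1 (iota k)).
rewrite !iotaD iotaZ (iota_central (cpl_central mu_cpl x hc) hk) addr0.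
rewrite (lie_bracketC (mu x (L p))) iotaN (iota_brI H) lam_mu mulr0 oppr0 add0r.
by rewrite (iota_brL H) !mulNr => /oppr_inj.
Qed.

Lemma iota_mu_brLL x p q k : ~~ central_index a b k ->
  (p - q)%:~R * iota k (mu x (L (p + q))) =
  (a + (k - q)%:~R + b * q%:~R) * iota (k - q) (mu x (L p)) -
  (a + (k - p)%:~R + b * p%:~R) * iota (k - p) (mu x (L q)).
Proof.
move=> hk; have [c hc E] := brLL HL p q.
have := cpl_bracketr mu_cpl x (L p) (L q).
rewrite {}E linearDr linearZr_LR => /(congr1 (iota k)).
rewrite !iotaD iotaZ (iota_central (cpl_central mu_cpl x hc) hk) addr0 => ->.
by rewrite lie_bracketC iotaN !(iota_brL H) !mulNr opprK.
Qed.

Lemma iota_mu_I_off x n k : ~~ central_index a b k -> k != n ->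
  iota k (mu x (I n)) = 0.
Proof.
move=> hk kn; have := iota_mu_brLI x 0 n hk.
rewrite mulr0 subr0 !addr0 add0r => E; apply: (@intr_mul_eq0 _ (n - k)).
  by lia.
transitivity ((a + n%:~R) * iota k (mu x (I n)) -
  (a + k%:~R) * iota k (mu x (I n))); first by ring.
by rewrite E subrr.
Qed.

Lemma iota_mu_II m n k : ~~ central_index a b k ->
  iota k (mu (I m) (I n)) = 0.
Proof.
move=> hk; have [kn|kn] := eqVneq k n; last exact: iota_mu_I_off.
have [nm|nm] := eqVneq n m; last first.
  by rewrite (cpl_comm mu_cpl) iota_mu_I_off // kn.
(* The rule at coordinate [n + p] turns the left product into an off-diagonal one, so one [p] with a
   nonzero factor suffices. *)
subst k m; have E p : p != 0 -> ~~ central_index a b (n + p) ->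
    a + n%:~R + b * p%:~R != 0 -> iota n (mu (I n) (I n)) = 0.
  move=> p0 hp cp; have := iota_mu_brLI (I n) p n hp.
  rewrite (cpl_comm mu_cpl _ (I (p + n))) iota_mu_I_off //; last by lia.
  by rewrite mulr0 addrK => /esym/eqP; rewrite mulf_eq0 (negPf cp) => /eqP.
(* For [b = 0] the factor is [a + n], nonzero by [hk], and [p] must only avoid [n + p = 0]. *)
have [b0|b0] := eqVneq b 0.
  have an : a + n%:~R != 0.
    apply: contraNN hk => /eqP /a_int[-> ->].
    by rewrite /central_index b0 !eqxx.
  have [n1|n1] := eqVneq n (-1).
    apply: (E 2); rewrite ?b0 ?mul0r ?addr0 // /central_index.
    by rewrite n1 !andbF.
  apply: (E 1); rewrite ?b0 ?mul0r ?addr0 // /central_index.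
  by rewrite (_ : (n + 1 == 0) = false) ?andbF //; lia.
have good p : ~~ central_index a b p by rewrite /central_index (negPf b0) andbF.
(* For [b != 0] the factors at [p = 1] and [p = 2] differ by [b], so they are not both 0. *)
have [E1|] := eqVneq (a + n%:~R + b * 1%:~R) 0; last exact: E.
apply: (E 2) => //; apply: contraNN b0 => /eqP E2; apply/eqP.
transitivity ((a + n%:~R + b * 2%:~R) - (a + n%:~R + b * 1%:~R)).
  by ring.
by rewrite E1 E2 subrr.
Qed.

Lemma iota_mu_IL m n k : ~~ central_index a b k ->
  iota k (mu (I n) (L m)) = 0.
Proof.
move=> hk; have [kn|kn] := eqVneq k n; last first.
  by rewrite (cpl_comm mu_cpl) iota_mu_I_off.
subst k; have [p [q [-> pq p0 q0]]] := int_split m.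
(* The coordinate is off the diagonal; if [n - r] is the exceptional index, the factor vanishes
   instead. *)
have E r s : r != 0 ->
    (a + (n - r)%:~R + b * r%:~R) * iota (n - r) (mu (I n) (L s)) = 0.
  move=> r0; have [/and3P[/eqP-> /eqP-> /eqP->]|hr] :=
      boolP (central_index a b (n - r)).
    by rewrite mul0r !addr0 mul0r.
  by rewrite (cpl_comm mu_cpl) iota_mu_I_off ?mulr0 //; lia.
have := iota_mu_brLL (I n) p q hk; rewrite !E // subr0.
by apply: intr_mul_eq0; lia.
Qed.

(** No [L]-coordinate survives, and an [I]-coordinate survives only where [I k] is itself central,
    so the product is a combination of central elements. *)
Lemma mu_I_central x n : lie_central (mu x (I n)).
Proof.
have C y : (forall k, ~~ central_index a b k -> iota k (mu y (I n)) = 0) ->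
    lie_central (mu y (I n)).
  move=> hy; apply: (W_ind H (P := @lie_central _ g)) => // [||k|k nk].
  - exact: lie_central0.
  - by move=> c z z'; apply: lie_centralP.
  - by rewrite lam_mu eqxx.
  - apply: (central_indexP H); apply: contraNT nk => /hy->.
    by rewrite eqxx.
apply: (W_ind H (P := fun x => lie_central (mu x (I n)))) => [|c z z'|m _|m _|c hc].
- by rewrite linear0l; apply: lie_central0.
- by rewrite linearPl; apply: lie_centralP.
- by apply: C => k hk; rewrite (cpl_comm mu_cpl) iota_mu_IL.
- by apply: C => k hk; rewrite iota_mu_II.
- by rewrite (cpl_comm mu_cpl); apply: cpl_central.
Qed.

Lemma mu_mu_central x y z : lie_central (mu x (mu y z)).
Proof.
apply: (W_ind H (P := fun w => lie_central (mu x w))) => [|c w w'|m|m _|c hc].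
- by rewrite linear0r; apply: lie_central0.
- by rewrite linearPr; apply: lie_centralP.
- by rewrite lam_mu eqxx.
- exact: mu_I_central.
- exact: cpl_central.
Qed.

Lemma mu_central x y : lie_central (mu x y).
Proof.
apply: (W_ind H (P := fun x => lie_central (mu x y))) => [|c z z'|m _|m _|c hc].
- by rewrite linear0l; apply: lie_central0.
- by rewrite linearPl; apply: lie_centralP.
- have [p [q [-> pq _ _]]] := int_split m; have [c hc E] := brLL HL p q.
  (* Without the central remainder [c] the bracket is [(p - q) L m], and its product with [y] is a
     difference of double products. *)
  have : lie_central (mu lie[L p, L q] y - mu c y).
    rewrite (cpl_bracketl mu_cpl) addrC -scaleN1r; apply: lie_centralP.
      by rewrite (cpl_comm mu_cpl); apply: cpl_central.
    rewrite addrC -scaleN1r.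
    by apply: lie_centralP; apply: mu_mu_central.
  rewrite E linearDl addrK linearZl_LR => hz.
  have n0 : (p - q)%:~R != 0 :> K by rewrite intr_eq0 subr_eq0.
  rewrite -[mu _ _]scale1r -(mulVf n0) -scalerA.
  exact: lie_centralZ.
- by rewrite (cpl_comm mu_cpl); apply: mu_I_central.
- by rewrite (cpl_comm mu_cpl); apply: cpl_central.
Qed.

End WPart.

(** * Coordinates in an algebra given by structure constants *)

Section StructureConstantsFacts.
Variables (K : numFieldType) (T : choiceType) (f : T -> T -> {malg K[T]}).
Hypotheses (f_anti : forall i j, f i j = - f j i)
  (f_jacobi : forall i j k,
    bilin_ext f << i >> (f j k) + bilin_ext f << j >> (f k i) +
    bilin_ext f << k >> (f i j) = 0).

Lemma malg_ind_supp (P : {malg K[T]} -> Prop) (x : {malg K[T]}) :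
  P 0 -> (forall c y z, P y -> P z -> P (c *: y + z)) ->
  (forall i, x@_i != 0 -> P << i >>) -> P x.
Proof.
move=> P0 PD PU; rewrite [x in P x]malg_basisE big_seq.
by elim/big_rec: _ => // i y xi; apply: PD; apply: PU; rewrite mcoeff_neq0.
Qed.

(** Bracketing with a basis vector feeds coordinate [k] from the single coordinate [k']; the
    coordinate rules of both records thus reduce to structure constants. *)
Lemma mcoeff_bilin_ext s k k' (c : K) (x : {malg K[T]}) :
  (forall t, (f s t)@_k = c * (t == k')%:R) ->
  (bilin_ext f << s >> x)@_k = c * x@_k'.
Proof.
move=> fs; elim/malg_ind_lin: x => [|d x y IHx IHy|t].
- by rewrite bilin_ext0r !mcoeff0 mulr0.
- rewrite bilin_extPr mcoeffD mcoeffZ (mcoeffD _ (d *: x)) mcoeffZ.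
  rewrite mulrDr mulrCA.
  by congr (_ * _ + _).
- by rewrite bilin_extUU fs mcoeffU.
Qed.

Let g := lie_of_basis f_anti f_jacobi.

Lemma basis_bracket i j : lie[(<< i >> : g), (<< j >> : g)] = f i j.
Proof. exact: bilin_extUU. Qed.

Lemma basis_central i : (forall j, f i j = 0) -> lie_central (<< i >> : g).
Proof.
move=> fi x; elim/malg_ind_lin: x => [|c x y IHx IHy|j].
- exact: linear0r.
- by rewrite linearPr IHx IHy scaler0 addr0.
- by rewrite basis_bracket.
Qed.

End StructureConstantsFacts.

(** * Membership in the derived subalgebra *)

Section Derived.
Variables (K : fieldType) (g : lieAlgebra K).
Implicit Types x y : g.

Lemma derived0 : derived_subalgebra (0 : g).
Proof. by exists [::]; rewrite big_nil. Qed.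

Lemma derivedP c x y : derived_subalgebra x -> derived_subalgebra y ->
  derived_subalgebra (c *: x + y).
Proof.
move=> [s ->] [t ->]; exists ([seq (c * u.1, u.2) | u <- s] ++ t).
rewrite big_cat big_map scaler_sumr; congr (_ + _).
by apply: eq_bigr => u _; rewrite scalerA.
Qed.

Lemma derivedZ c x : derived_subalgebra x -> derived_subalgebra (c *: x).
Proof. by move=> hx; rewrite -[_ *: _]addr0; apply: derivedP derived0. Qed.

Lemma derived_bracket x y : derived_subalgebra lie[x, y].
Proof. by exists [:: (1, (x, y))]; rewrite big_seq1 scale1r. Qed.

Lemma derived_solve k x y z r : lie[y, z] = r + k *: x -> k != 0 ->
  derived_subalgebra r -> derived_subalgebra x.
Proof.
move=> E k0 hr; have -> : x = k^-1 *: (- 1 *: r + lie[y, z]).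
  by rewrite E addrA scaleN1r addNr add0r scalerA mulVf ?scale1r.
by apply/derivedZ/derivedP => //; apply: derived_bracket.
Qed.

Lemma derived_solve0 k x y z : lie[y, z] = k *: x -> k != 0 ->
  derived_subalgebra x.
Proof.
move=> E k0; apply: (derived_solve (y := y) (z := z) (r := 0)) k0 derived0.
by rewrite E add0r.
Qed.

Lemma perfect_trivial (mu : {bilinear g -> g -> g}) :
  commutative_post_lie mu -> (forall x y, lie_central (mu x y)) ->
  (forall x, derived_subalgebra x) -> trivial_product mu.
Proof. by move=> hmu mu_c D x y; apply: cpl_derived_eq0. Qed.

End Derived.

(** * The Witt and Virasoro algebras *)

Section WittVirasoro.
Variable K : numFieldType.

Lemma witt_wittP :
  witt_coordinates (g := witt K) (fun n => << n >>) (fun k x => x@_k).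
Proof.
split=> [k c x y|m n|k m x].
- by rewrite mcoeffD mcoeffZ.
- exists 0; first exact: lie_central0.
  by rewrite addr0 basis_bracket.
- apply: mcoeff_bilin_ext => t; rewrite mcoeffZ mcoeffU.
  rewrite (_ : (m + t == k) = (t == k - m)); last by lia.
  by case: eqP => [->|_]; rewrite ?mulr0 // !mulr1; congr _%:~R; lia.
Qed.

Lemma witt_trivial (mu : {bilinear witt K -> witt K -> witt K}) :
  commutative_post_lie mu -> trivial_product mu.
Proof.
move=> hmu x y; elim/malg_ind_lin: x => [|c x x' IHx IHx'|m].
- exact: linear0l.
- by rewrite linearPl IHx IHx' scaler0 addr0.
elim/malg_ind_lin: y => [|c y y' IHy IHy'|n].
- exact: linear0r.
- by rewrite linearPr IHy IHy' scaler0 addr0.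
by apply/malgP => k; rewrite (lam_mu_LL witt_wittP hmu) mcoeff0.
Qed.

Lemma virC0_central : lie_central (virC0 K : virasoro K).
Proof. exact: basis_central. Qed.

Lemma virasoro_wittP :
  witt_coordinates (g := virasoro K) (virL K) (fun k x => x@_(inl k)).
Proof.
split=> [k c x y|m n|k m x].
- by rewrite mcoeffD mcoeffZ.
- exists (((m ^+ 3 - m)%:~R / 12%:R * kron K (m + n) 0) *: virC0 K).
    exact: lie_centralZ virC0_central.
  by rewrite basis_bracket.
- apply: mcoeff_bilin_ext => -[t|[]]; last by rewrite mcoeff0 mulr0.
  rewrite (inj_eq inl_inj) mcoeffD !mcoeffZ !mcoeffU (inj_eq inl_inj) mulr0 addr0.
  rewrite (_ : (m + t == k) = (t == k - m)); last by lia.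
  by case: eqP => [->|_]; rewrite ?mulr0 // !mulr1; congr _%:~R; lia.
Qed.

Lemma virasoro_derived (x : virasoro K) : derived_subalgebra x.
Proof.
have L n : derived_subalgebra (virL K n : virasoro K).
  have [->|n0] := eqVneq n 0.
    apply: (@derived_solve0 _ _ 2 _ (virL K 1 : virasoro K) (virL K (-1)));
      rewrite ?pnatr_eq0 //.
    by rewrite basis_bracket /= subrr mul0r mul0r scale0r addr0.
  apply: (@derived_solve0 _ _ n%:~R _ (virL K n : virasoro K) (virL K 0));
    rewrite ?intr_eq0 //.
  rewrite basis_bracket /= subr0 ?addr0 /kron (negPf n0).
  by rewrite mulr0 scale0r ?addr0.
elim/malg_ind_lin: x => [|c x y|[n|[]]]; [exact: derived0|exact: derivedP| |].
  exact: L.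
(* This is the coefficient of [virC0] in the bracket of [L_2] and [L_{-2}], whose other term is
   [4 L_0]. *)
have e : (2 ^+ 3 - 2 : int)%:~R / 12%:R * kron K (2 - 2 : int) 0 = 2^-1.
  by rewrite /kron subrr mulr1; field.
apply: (@derived_solve _ _ 2^-1 _ (virL K 2 : virasoro K) (virL K (-2))
  ((2 - -2)%:~R *: virL K (2 - 2))); last exact: derivedZ.
  by rewrite basis_bracket -e.
by rewrite invr_eq0 pnatr_eq0.
Qed.

Lemma virasoro_trivial (mu : {bilinear virasoro K -> virasoro K -> virasoro K}) :
  commutative_post_lie mu -> trivial_product mu.
Proof.
move=> hmu; apply: perfect_trivial => // [x y|]; last exact: virasoro_derived.
elim/malg_ind_lin: x => [|c x x' IHx IHx'|[m|[]]].
- by rewrite linear0l; apply: lie_central0.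
- by rewrite linearPl; apply: lie_centralP.
- elim/malg_ind_lin: y => [|c y y' IHy IHy'|[n|[]]].
  + by rewrite linear0r; apply: lie_central0.
  + by rewrite linearPr; apply: lie_centralP.
  (* With no [L]-coordinate left, the product is a multiple of [virC0]. *)
  + apply: (malg_ind_supp (P := @lie_central _ (virasoro K))).
    * exact: lie_central0.
    * by move=> c y z; apply: lie_centralP.
    * move=> [k|[] _]; last exact: virC0_central.
      by rewrite (lam_mu_LL virasoro_wittP hmu) eqxx.
  + by apply: (cpl_central hmu); apply: virC0_central.
- by rewrite (cpl_comm hmu); apply: (cpl_central hmu); apply: virC0_central.
Qed.

End WittVirasoro.

Lemma lincomb3P (K : fieldType) (V : lmodType K) (c p q r p' q' r' : K)
    (u v w : V) :
  c *: (p *: u + q *: v + r *: w) + (p' *: u + q' *: v + r' *: w) =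
  (c * p + p') *: u + (c * q + q') *: v + (c * r + r') *: w.
Proof.
rewrite !scalerDr !scalerDl !scalerA addrACA; congr (_ + _).
by rewrite addrACA.
Qed.

(** * The algebras [W a b] and [Wtilde a b] *)

Section WWtilde.
Variables (K : numFieldType) (a b : K).

Lemma unit_interval_int : 0 <= a < 1 ->
  forall j : int, a + j%:~R = 0 -> a = 0 /\ j = 0.
Proof.
move=> /andP[a0 a1] j /eqP; rewrite addr_eq0 -rmorphN => /eqP E.
move: a0 a1; rewrite E ler0z -[1]/(1%:~R) ltr_int => j0 j1.
by have -> : j = 0 by lia.
Qed.

(** This serves to reach [I k] from the bracket of [L m] and [I (k - m)]. The choice [m = 0] works
    unless [a = k = 0]; then [m = -1] gives [b - 1], and it is a root of [m ^+ 2 + m] and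
    [m ^+ 3 - m], the factors of central terms. *)
Lemma bracket_coef_neq0 (k : int) :
  (forall j : int, a + j%:~R = 0 -> a = 0 /\ j = 0) -> ~ (a = 0 /\ b = 1) ->
  exists2 m : int, - (a + (k - m)%:~R + b * m%:~R) != 0 &
    (a = 0 -> k = 0 -> m = -1).
Proof.
move=> ha hab; have [ak|ak] := eqVneq (a + k%:~R) 0.
  have [a0 k0] := ha _ ak; exists (-1) => //.
  apply/eqP => E; apply: hab; split=> //.
  rewrite -[RHS]addr0 -E a0 k0; ring.
exists 0; first by rewrite oppr_eq0 subr0 mulr0 addr0.
by move=> a0 k0; rewrite a0 k0 addr0 eqxx in ak.
Qed.

Lemma W_coordP : W_coordinates (g := W a b) a b (WL K) (WI K)
  (fun k x => x@_(inl k)) (fun k x => x@_(inr k)).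
Proof.
split.
- split=> [k c x y|m n|k m x].
  + by rewrite mcoeffD mcoeffZ.
  + exists 0; first exact: lie_central0.
    by rewrite addr0 basis_bracket.
  + apply: mcoeff_bilin_ext => -[t|t]; rewrite mcoeffZ mcoeffU ?mulr0 //.
    rewrite !(inj_eq inl_inj) (_ : (m + t == k) = (t == k - m)); last by lia.
    by case: eqP => [->|_]; rewrite ?mulr0 // !mulr1; congr _%:~R; lia.
- by move=> k c x y; rewrite mcoeffD mcoeffZ.
- move=> m n; exists 0; first exact: lie_central0.
  by rewrite addr0 basis_bracket.
- move=> k n x; rewrite -[RHS](mul0r x@_(inl 0)).
  apply: mcoeff_bilin_ext => -[t|t]; last by rewrite mcoeff0 mul0r.
  by rewrite mcoeffZ mcoeffU mulr0 mul0r.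
- move=> k m x; apply: mcoeff_bilin_ext => -[t|t]; rewrite mcoeffZ mcoeffU ?mulr0 //.
  rewrite !(inj_eq inr_inj) (_ : (m + t == k) = (t == k - m)); last by lia.
  by case: eqP => [->|_]; rewrite ?mulr0.
- move=> k n x; apply: mcoeff_bilin_ext => -[t|t]; last by rewrite mcoeff0 mulr0.
  rewrite mcoeffZ mcoeffU (inj_eq inr_inj) (inj_eq inl_inj).
  rewrite (_ : (t + n == k) = (t == k - n)); last by lia.
  by case: eqP => [->|_]; rewrite ?mulr0.
- move=> n /and3P[/eqP a0 /eqP b0 /eqP n0]; apply: basis_central => -[m|//].
  by rewrite /= a0 b0 n0 mul0r !addr0 scale0r.
- move=> P x P0 PP PL PI _; apply: malg_ind_supp => // -[n|n].
    exact: PL.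
  exact: PI.
Qed.

Hypothesis a_int : forall j : int, a + j%:~R = 0 -> a = 0 /\ j = 0.

Lemma W_derived (x : W a b) : ~ (a = 0 /\ b = 1) -> derived_subalgebra x.
Proof.
move=> hab; elim/malg_ind_lin: x => [|c x y|[n|n]].
- exact: derived0.
- exact: derivedP.
- have [m [p [-> mp _ _]]] := int_split n.
  apply: (@derived_solve0 _ _ (m - p)%:~R _ (WL K m : W a b) (WL K p)).
    exact: basis_bracket.
  by rewrite intr_eq0 subr_eq0.
- have [m c0 _] := bracket_coef_neq0 n a_int hab.
  apply: (derived_solve0 (y := WL K m : W a b) (z := WI K (n - m)) _ c0).
  by rewrite basis_bracket /= (_ : m + (n - m) = n) //; lia.
Qed.

Lemma W_trivial (mu : {bilinear W a b -> W a b -> W a b}) :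
  commutative_post_lie mu -> trivial_product mu.
Proof.
move=> hmu; have mu_c := mu_central W_coordP a_int hmu.
(* For [(a, b) = (0, 1)] the algebra is not perfect, but its centre is 0. *)
have [/andP[_ /eqP b1]|hab] := boolP ((a == 0) && (b == 1)).
  move=> x y; apply/malgP => -[k|k]; rewrite mcoeff0.
    exact: (lam_central (W_witt W_coordP) k (mu_c x y)).
  apply: (iota_central W_coordP a_int (mu_c x y)).
  by rewrite /central_index b1 oner_eq0 andbF.
apply: perfect_trivial => // x; apply: W_derived => -[a0 b1].
by rewrite a0 b1 !eqxx in hab.
Qed.

Local Notation g := (Wtilde a b).

Lemma WtC_val (c : {c : central_idx | occurs a b c}) :
  WtC a b (val c) = << inr c >>.
Proof. by rewrite /WtC valK. Qed.

Lemma WtC_central c : lie_central (WtC a b c : g).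
Proof.
rewrite /WtC; case: insubP => [d _ _|_]; last exact: lie_central0.
exact: basis_central.
Qed.

Lemma mcoeff_WtC c i : (WtC a b c)@_(inl i) = 0.
Proof.
by rewrite /WtC; case: insubP => [d _ _|_]; rewrite ?mcoeff0 // mcoeffU.
Qed.

Lemma mcoeff_Wt_brLI m n i : (Wt_brLI a b m n)@_(inl i) =
  - (a + n%:~R + b * m%:~R) * (inr (m + n) == i)%:R.
Proof.
rewrite Wt_brLIE !mcoeffD !mcoeffZ !mcoeff_WtC !mulr0 !addr0 mcoeffU.
by rewrite (inj_eq inl_inj).
Qed.

Lemma Wt_coordP : W_coordinates (g := g) a b (WtL a b) (WtI a b)
  (fun k x => x@_(inl (inl k))) (fun k x => x@_(inl (inr k))).
Proof.
have C := WtC_central.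
split.
- split=> [k c x y|m n|k m x].
  + by rewrite mcoeffD mcoeffZ.
  + exists (((m ^+ 3 - m)%:~R / 12%:R * kron K (m + n) 0) *: WtC a b cC0).
      exact/lie_centralZ/C.
    by rewrite basis_bracket.
  + apply: mcoeff_bilin_ext => -[[t|t]|c] /=.
    * rewrite mcoeffD !mcoeffZ mcoeff_WtC mcoeffU mulr0 addr0 !(inj_eq inl_inj).
      rewrite (_ : (m + t == k) = (t == k - m)); last by lia.
      by case: eqP => [->|_]; rewrite ?mulr0 // !mulr1; congr _%:~R; lia.
    * by rewrite mcoeff_Wt_brLI ?(inj_eq inl_inj) !mulr0.
    * by rewrite mcoeff0 mulr0.
- by move=> k c x y; rewrite mcoeffD mcoeffZ.
- move=> m n; eexists; last by rewrite basis_bracket; reflexivity.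
  by do ?[apply: C | apply: lie_centralZ | apply: lie_centralD].
- move=> k n x; rewrite -[RHS](mul0r x@_(inl (inl 0))).
  apply: mcoeff_bilin_ext => -[[t|t]|c] /=.
  + by rewrite mcoeffN mcoeff_Wt_brLI mulr0 oppr0 mul0r.
  + by rewrite mcoeffD !mcoeffZ !mcoeff_WtC !mulr0 addr0 ?mul0r.
  + by rewrite mcoeff0 mul0r.
- move=> k m x; apply: mcoeff_bilin_ext => -[[t|t]|c] /=.
  + by rewrite mcoeffD !mcoeffZ mcoeff_WtC mcoeffU ?(inj_eq inl_inj) !mulr0 addr0.
  + rewrite mcoeff_Wt_brLI (inj_eq inl_inj) !(inj_eq inr_inj).
    rewrite (_ : (m + t == k) = (t == k - m)); last by lia.
    by case: eqP => [->|_]; rewrite ?mulr0.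
  + by rewrite mcoeff0 mulr0.
- move=> k n x; apply: mcoeff_bilin_ext => -[[t|t]|c] /=.
  + rewrite mcoeffN mcoeff_Wt_brLI !(inj_eq inl_inj) !(inj_eq inr_inj) mulNr opprK.
    rewrite (_ : (t + n == k) = (t == k - n)); last by lia.
    by case: eqP => [->|_]; rewrite ?mulr0.
  + by rewrite mcoeffD !mcoeffZ !mcoeff_WtC ?(inj_eq inl_inj) !mulr0 addr0.
  + by rewrite mcoeff0 mulr0.
(* With [L m] a central term could occur only at [m = 0], where [m ^+ 2 + m] is 0; with [I m] the
   factor of [C_2^0] is the index 0. *)
- move=> n /and3P[/eqP a0 /eqP b0 /eqP n0]; apply: basis_central => -[[m|m]|//] /=.
    have c0 : a + n%:~R + b * m%:~R = 0 by rewrite a0 b0 n0 mul0r !addr0.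
    rewrite Wt_brLIE c0 oppr0 scale0r add0r /kron a0 b0 n0 addr0.
    rewrite (eq_sym 0 1) oner_eq0 (eq_sym 0 (-1)) oppr_eq0 oner_eq0.
    rewrite !(mulr0, mul0r, scale0r, addr0).
    have [->|] := eqVneq m 0; last by rewrite !mul0r scale0r ?oppr0.
    by rewrite !(mulr0, mul0r, scale0r) ?oppr0.
  have ka : kron K a 2%:R^-1 = 0.
    by rewrite /kron a0 eq_sym invr_eq0 (pnatr_eq0 K 2).
  by rewrite n0 ka !mul0r !mulr0 mul0r !scale0r addr0.
- move=> P x P0 PP PL PI PC; apply: malg_ind_supp => // -[[n|n]|c].
  + exact: PL.
  + exact: PI.
  + by rewrite -WtC_val => _; apply/PC/C.
Qed.

(** * Perfectness of [Wtilde a b] for [(a, b)] other than [(0, 1)] *)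

Section Perfect.
Hypothesis hab : ~ (a = 0 /\ b = 1).

Lemma WtL_derived n : derived_subalgebra (WtL a b n : g).
Proof.
have [->|n0] := eqVneq n 0.
  apply: (@derived_solve0 _ _ 2 _ (WtL a b 1 : g) (WtL a b (-1)));
    rewrite ?pnatr_eq0 //.
  by rewrite basis_bracket /= subrr mul0r mul0r scale0r addr0.
apply: (@derived_solve0 _ _ n%:~R _ (WtL a b n : g) (WtL a b 0));
  rewrite ?intr_eq0 //.
rewrite basis_bracket /= subr0 ?addr0 /kron (negPf n0).
by rewrite mulr0 scale0r ?addr0.
Qed.

Lemma kron_b1 : kron K a 0 * kron K b 1 = 0.
Proof.
rewrite /kron -natrM mulnb; case: andP => // -[/eqP a0 /eqP b1].
by case: hab.
Qed.

Lemma WtI_derived n : derived_subalgebra (WtI a b n : g).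
Proof.
have [m c0 mE] := bracket_coef_neq0 n a_int hab.
apply: (derived_solve0 (y := WtL a b m : g) (z := WtI a b (n - m)) _ c0).
rewrite basis_bracket /= Wt_brLIE (_ : m + (n - m) = n); last by lia.
rewrite -[RHS]addr0 -!addrA; congr (_ + _).
rewrite -!(mulrA (kron K n 0)) kron_b1 !(mulr0, mul0r, scale0r, add0r, addr0).
rewrite /kron; have [n0|_] := eqVneq n 0; last by rewrite !mul0r !scale0r addr0.
have [a0|_] := eqVneq a 0; last by rewrite !(mulr0, mul0r, scale0r) addr0.
(* Here [m = -1] kills the remaining central terms. *)
rewrite (mE a0 n0) (_ : (-1) ^+ 2 + -1 = 0 :> int) //.
by rewrite (_ : (-1) ^+ 3 - -1 = 0 :> int) // !(mulr0, mul0r, scale0r) addr0.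
Qed.

(** Each occurring central vector has a nonzero coefficient in one bracket: [C_0] in
    [[L_2, L_{-2}]], [C_1^0] in [[L_1, I_{-1}]], [C_2^0] in [[I_1, I_{-1}]], [C_1^{-1}] in
    [[L_2, I_{-2}]] and [C_2^{1/2,0}] in [[I_0, I_{-1}]]. *)
Lemma WtC_derived c : derived_subalgebra (WtC a b c : g).
Proof.
have [oc|nc] := boolP (occurs a b c); last by rewrite /WtC insubN //; apply: derived0.
have k0 : kron K (0 : int) 0 = 1 by rewrite /kron eqxx.
have half0 : 2^-1 != 0 :> K by rewrite invr_eq0 pnatr_eq0.
have e : (2 ^+ 3 - 2 : int)%:~R / 12%:R = 2^-1 :> K by field.
case: c oc => /=.
- move=> _; apply: (@derived_solve _ _ 2^-1 _ (WtL a b 2 : g) (WtL a b (-2))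
    ((2 - -2)%:~R *: WtL a b (2 - 2))) => //; last exact/derivedZ/WtL_derived.
  by rewrite basis_bracket /Wt_br e k0 mulr1.
- move=> /andP[a0 b0].
  have ka : kron K a 0 = 1 by rewrite /kron a0.
  have kb : kron K b 0 = 1 by rewrite /kron b0.
  have kb1 : kron K b 1 = 0 by rewrite /kron (eqP b0) eq_sym oner_eq0.
  have kbN1 : kron K b (-1) = 0.
    by rewrite /kron (eqP b0) eq_sym oppr_eq0 oner_eq0.
  apply: (@derived_solve _ _ (1 ^+ 2 + 1 : int)%:~R _ (WtL a b 1 : g)
    (WtI a b (-1)) (- (a + (-1)%:~R + b * 1%:~R) *: WtI a b (1 - 1))).
  + rewrite basis_bracket /Wt_br Wt_brLIE ka kb kb1 kbN1 k0 !mulr0 !mul0r.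
    by rewrite !scale0r !addr0 !mulr1 mul1r.
  + by rewrite intr_eq0.
  + exact/derivedZ/WtI_derived.
- move=> /andP[a0 b0].
  have ka : kron K a 0 = 1 by rewrite /kron a0.
  have kb : kron K b 0 = 1 by rewrite /kron b0.
  have k1 : kron K (1 - 1 + 1 : int) 0 = 0 by [].
  apply: (@derived_solve0 _ _ 1 _ (WtI a b 1 : g) (WtI a b (-1))).
    rewrite basis_bracket /Wt_br k1 ka kb k0 mulr0 !mul0r scale0r addr0.
    by rewrite !mulr1.
  exact: oner_neq0.
- by move=> /andP[/eqP a0 /eqP b1]; case: hab.
- by move=> /andP[/eqP a0 /eqP b1]; case: hab.
- move=> /andP[a0 b0].
  have ka : kron K a 0 = 1 by rewrite /kron a0.
  have kb : kron K b (-1) = 1 by rewrite /kron b0.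
  have kb0 : kron K b 0 = 0 by rewrite /kron (eqP b0) oppr_eq0 oner_eq0.
  have kb1 : kron K b 1 = 0.
    by rewrite /kron (eqP b0) eqNr oner_eq0.
  apply: (@derived_solve _ _ 2^-1 _ (WtL a b 2 : g) (WtI a b (-2))
    (- (a + (-2)%:~R + b * 2%:~R) *: WtI a b (2 - 2))) => //.
    rewrite basis_bracket /Wt_br Wt_brLIE ka kb kb0 kb1 k0 e !mulr0 !mul0r.
    by rewrite !scale0r !addr0 !mulr1 mul1r.
  exact/derivedZ/WtI_derived.
- move=> /andP[a2 b0].
  have ka : kron K a 2^-1 = 1 by rewrite /kron a2.
  have kb : kron K b 0 = 1 by rewrite /kron b0.
  have k1 : kron K (0 - 1 : int) 0 = 0 by [].
  have k2 : kron K (0 - 1 + 1 : int) 0 = 1 by [].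
  apply: (@derived_solve0 _ _ 1 _ (WtI a b 0 : g) (WtI a b (-1))).
    rewrite basis_bracket /Wt_br k1 k2 ka kb !(mul0r, mulr0) scale0r add0r.
    by rewrite !mulr1.
  exact: oner_neq0.
Qed.

Lemma Wt_derived (x : g) : derived_subalgebra x.
Proof.
elim/malg_ind_lin: x => [|c x y|[[n|n]|c]].
- exact: derived0.
- exact: derivedP.
- exact: WtL_derived.
- exact: WtI_derived.
- by rewrite -WtC_val; apply: WtC_derived.
Qed.

Lemma Wt_trivial (mu : {bilinear g -> g -> g}) :
  commutative_post_lie mu -> trivial_product mu.
Proof.
move=> hmu; apply: perfect_trivial hmu (mu_central Wt_coordP a_int hmu) _.
exact: Wt_derived.
Qed.

End Perfect.

(** * The exceptional algebra [Wtilde 0 1] *)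

Lemma Wt_central_span (x : g) : a = 0 -> b = 1 -> lie_central x ->
  exists p q r, x = p *: WtC a b cC0 + q *: WtC a b cC1_1 + r *: WtC a b cC2_1.
Proof.
move=> a0 b1 hx.
apply: (malg_ind_supp (P := fun x => exists p q r,
  x = p *: WtC a b cC0 + q *: WtC a b cC1_1 + r *: WtC a b cC2_1)).
- by exists 0, 0, 0; rewrite !scale0r !addr0.
- move=> c _ _ [p [q [r ->]]] [p' [q' [r' ->]]].
  exists (c * p + p'), (c * q + q'), (c * r + r').
  exact: lincomb3P.
move=> [[k|k]|c].
- by rewrite (lam_central (W_witt Wt_coordP) k hx) eqxx.
- rewrite (iota_central Wt_coordP a_int hx) ?eqxx //.
  by rewrite /central_index b1 oner_eq0 andbF.
move=> _; rewrite -WtC_val; case: c => c /=.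
(* As [b = 1] is neither 0 nor -1, only [C_0], [C_1^1] and [C_2^1] occur. *)
case: c => /=; rewrite ?b1 ?[1 == -1]eq_sym ?eqNr ?oner_eq0 ?andbF // => _.
- by exists 1, 0, 0; rewrite !scale0r !addr0 scale1r.
- by exists 0, 1, 0; rewrite !scale0r addr0 add0r scale1r.
- by exists 0, 0, 1; rewrite !scale0r !add0r scale1r.
Qed.

End WWtilde.

(** Expanding the product of [I_0 + x] and [I_0 + y], the terms with a derived factor vanish, and
    the square of [I_0] is central; its three central coordinates are the parameters. *)
Lemma Wt01_Lambda (K : numFieldType)
    (mu : {bilinear Wtilde (0 : K) 1 -> Wtilde (0 : K) 1 -> Wtilde (0 : K) 1}) :
  commutative_post_lie mu -> exists p q r : K, is_Lambda p q r mu.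
Proof.
move=> hmu.
have h01 : 0 <= (0 : K) < 1 by rewrite lexx ltr01.
have z_int := unit_interval_int h01.
have mu_c := mu_central (Wt_coordP 0 1) z_int hmu.
have [p [q [r E]]] := Wt_central_span z_int erefl erefl
  (mu_c (WtI 0 1 0) (WtI 0 1 0)).
exists p, q, r => x y hx hy; rewrite linearDl !linearDr.
rewrite !(cpl_derived_eq0 hmu _ mu_c hy) (cpl_comm hmu x).
by rewrite (cpl_derived_eq0 hmu _ mu_c hx) !addr0.
Qed.

Theorem theorem6p3 (R : realType) :
  (forall mu : {bilinear witt R[i] -> witt R[i] -> witt R[i]},
     commutative_post_lie mu -> trivial_product mu) /\
  (forall mu : {bilinear virasoro R[i] -> virasoro R[i] -> virasoro R[i]},
     commutative_post_lie mu -> trivial_product mu) /\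
  (forall a b : R[i], 0 <= a < 1 ->
     forall mu : {bilinear W a b -> W a b -> W a b},
     commutative_post_lie mu -> trivial_product mu) /\
  (forall a b : R[i], 0 <= a < 1 -> ~ (a = 0 /\ b = 1) ->
     forall mu : {bilinear Wtilde a b -> Wtilde a b -> Wtilde a b},
     commutative_post_lie mu -> trivial_product mu) /\
  (forall mu : {bilinear Wtilde (0 : R[i]) 1 -> Wtilde (0 : R[i]) 1 ->
                         Wtilde (0 : R[i]) 1},
     commutative_post_lie mu -> ~ trivial_product mu ->
     exists a b c : R[i], is_Lambda a b c mu).
Proof.
split; first exact: witt_trivial.
split; first exact: virasoro_trivial.
split; first by move=> a b /unit_interval_int; apply: W_trivial.
split; last by move=> mu hmu _; apply: Wt01_Lambda.
by move=> a b /unit_interval_int a_int hab; apply: Wt_trivial.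
Qed.
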